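(* Let $n>m\ge 2$ be integers. a) An integer partition in $\mathcal{P}(n,m)$ is 1-minimal if it is of the form \[ \begin{cases} 1^{m-1}(n-m+1)^1 & \text{if } n-m\le 5,\\ q^{m-r}(q+1)^r & \text{if } n-m>5,\ n>5m,\ n=qm+r,\ 0\le r<m,\\ 1^{m-\frac{n-m}{4}}\,5^{\frac{n-m}{4}} & \text{if } n-m>5,\ n\le 5m \text{ and } m-n\equiv 0 \pmod 4,\\ 1^{m-\frac{n-m+1}{4}}\,4^1\,5^{\frac{n-m-3}{4}} & \text{if } n-m>5,\ n\le 5m \text{ and } m-n\equiv 1 \pmod 4,\\ 1^{m-\frac{n-m+2}{4}}\,4^2\,5^{\frac{n-m-6}{4}} & \text{if } n-m>5,\ n\le 5m \text{ and } m-n\equiv 2 \pmod 4,\\ 1^{m-\frac{n-m-1}{4}}\,5^{\frac{n-m-5}{4}}\,6^1 & \text{if } n-m>5,\ n\le 5m \text{ and } m-n\equiv 3 \pmod 4. \end{cases} \] b) An integer partition in $\mathcal{P}(n,m)$ is 1-maximal if it is of the form \[ \begin{cases} 2^{m-1}(n-2m+2)^1 & \text{if } n\ge 2m,\\ 1^{2m-n}\,2^{n-m} & \text{if } n<2m. \end{cases} \]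
   Context: $\mathcal{P}(n,m)$ is the set of all integer partitions $\boldsymbol{a}=(a_1,\dots,a_m)$ of $n$ into $m$ parts, i.e. $a_1,\dots,a_m$ are positive integers with $a_1+\dots+a_m=n$. The order of the parts is irrelevant. The notation $1^{\lambda_1}2^{\lambda_2}\cdots n^{\lambda_n}$ (items $i^0$ omitted) denotes the partition having exactly $\lambda_i$ parts equal to $i$; if the same base happens to appear twice in an expression, the multiplicities are added. Let $w_1(k)=1$ for all $k\in\{0,\dots,n\}$ and \[ F_{w_1}(a)=\sum_{k=0}^n\left(\binom{n-a}{k}+\binom{n-a}{k-a}\right)w_1(k), \] where $\binom{N}{k}=0$ if $k<0$ or $k>N$. A partition $\boldsymbol{a}\in\mathcal{P}(n,m)$ is called 1-minimal (resp. 1-maximal) if $\sum_{i=1}^m a_iF_{w_1}(a_i)$ attains at $\boldsymbol{a}$ its minimum (resp. maximum) over $\mathcal{P}(n,m)$. *)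

(* Defs.v *)
From mathcomp Require Import all_boot zify.

Set Implicit Arguments.
Unset Strict Implicit.
Unset Printing Implicit Defensive.

(* Partitions are represented by sequences of parts and compared up to
   [perm_eq]. *)
Definition partitions (n m : nat) : pred (seq nat) :=
  [pred a : seq nat | [&& size a == m, all (ltn 0) a & sumn a == n]].

(* The guard [a <= k] implements 'C(N, k - a) = 0 for negative k - a, which
   truncated subtraction would turn into 'C(N, 0) = 1. No guard is needed in
   n - a, since the parts of a partition of n are at most n. *)
Definition F (n : nat) (w : nat -> nat) (a : nat) : nat :=
  \sum_(k < n.+1)
     ('C(n - a, k) + (if a <= k then 'C(n - a, k - a) else 0)) * w k.

Definition w1 (k : nat) : nat := 1.

Definition weight (n : nat) (w : nat -> nat) (a : seq nat) : nat :=
  \sum_(x <- a) x * F n w x.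

Definition one_minimal (n m : nat) (a : seq nat) : Prop :=
  a \in partitions n m /\
  forall b : seq nat, b \in partitions n m -> weight n w1 a <= weight n w1 b.

Definition one_maximal (n m : nat) (a : seq nat) : Prop :=
  a \in partitions n m /\
  forall b : seq nat, b \in partitions n m -> weight n w1 b <= weight n w1 a.

(* [tally_seq [:: (i, l); (j, l'); ...]] is i^l j^l' ...; repeated bases have
   their multiplicities added. The congruence m - n = i (mod 4) is written
   m = n + i (mod 4), so the last branch is i = 3. In each branch the
   divisions by 4 are exact and no subtraction is truncated. *)
Definition min_form (n m : nat) : seq nat :=
  if n - m <= 5 then
    tally_seq [:: (1, m - 1); (n - m + 1, 1)]
  else if n > 5 * m then
    tally_seq [:: (n %/ m, m - n %% m); (n %/ m + 1, n %% m)]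
  else if m == n %[mod 4] then
    tally_seq [:: (1, m - (n - m) %/ 4); (5, (n - m) %/ 4)]
  else if m == n + 1 %[mod 4] then
    tally_seq [:: (1, m - (n - m + 1) %/ 4); (4, 1); (5, (n - m - 3) %/ 4)]
  else if m == n + 2 %[mod 4] then
    tally_seq [:: (1, m - (n - m + 2) %/ 4); (4, 2); (5, (n - m - 6) %/ 4)]
  else
    tally_seq [:: (1, m - (n - m - 1) %/ 4); (5, (n - m - 5) %/ 4); (6, 1)].

Definition max_form (n m : nat) : seq nat :=
  if n >= 2 * m then
    tally_seq [:: (2, m - 1); (n - 2 * m + 2, 1)]
  else
    tally_seq [:: (1, 2 * m - n); (2, n - m)].

Lemma min_form_partition (n m : nat) :
  2 <= m -> m < n -> min_form n m \in partitions n m.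
Proof.
move=> hm hmn; rewrite /min_form /partitions inE.
do 5?[case: ifP => ?];
  rewrite /tally_seq /= ?cats0 !size_cat !all_cat !sumn_cat !size_nseq
    !all_nseq !sumn_nseq /= ?size_nseq ?all_nseq ?sumn_nseq /= ?orbT; lia.
Qed.

Lemma max_form_partition (n m : nat) :
  2 <= m -> m < n -> max_form n m \in partitions n m.
Proof.
move=> hm hmn; rewrite /max_form inE.
case: ifP => ?;
  rewrite /tally_seq /= ?cats0 !size_cat !all_cat !sumn_cat !size_nseq
    !all_nseq !sumn_nseq /=; lia.
Qed.

(* Main.v *)
(** For a <= n both binomial sums in F_{w_1}(a) equal 2^(n-a), so the weight of
    a partition is 2^(n+1) times the sum of f(a_i), where f(x) = x / 2^x.
    The increments f(x+1) - f(x) = (1 - x) / 2^(x+1) are 0, -1/8, -1/8 and then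
    increase, so f is concave on {1, ..., 4} and convex on {2, 3, ...}.
    - If n - m <= 5, merging the excesses over 1 into a single part never
      increases the sum.
    - If n > 5m, the chord of f through q and q + 1, with q = n / m >= 5, lies
      below f on all positive integers, so the balanced partition is minimal.
    - Otherwise f is compared with its chord through 1 and 5. The scaled gap at
      x = t + 1 is at least (-t mod 4), which is subadditive in t; hence the
      total gap is at least (m - n) mod 4, and the listed forms attain it.
    - For the maximum, f(s+2) + f(t+2) <= f(2) + f(s+t+2) pushes all the excess
      over 2 into one part. *)
Require Import Defs.
From mathcomp Require Import all_boot.
From mathcomp Require Import all_order all_algebra zify ring lra.

Set Implicit Arguments.
Unset Strict Implicit.
Unset Printing Implicit Defensive.

Import Order.TTheory GRing.Theory Num.Theory.

Local Open Scope ring_scope.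

Section HalvingSums.

Context (R : realFieldType).

(** * Reduction of the weight to sums of [f] *)

Definition f (x : nat) : R := x%:R / 2 ^+ x.

Lemma F_w1 n x : (x <= n)%N -> F n w1 x = (2 ^ (n - x).+1)%N.
Proof.
move=> xn; rewrite /F /w1 -(big_mkord xpredT
  (fun k => (('C(n - x, k) + (if x <= k then 'C(n - x, k - x) else 0)) * 1)%N)).
have sum_bin N : (\sum_(0 <= k < N.+1) 'C(N, k) = 2 ^ N)%N.
  rewrite -[RHS]/((1 + 1) ^ N)%N expnDn big_mkord.
  by apply: eq_bigr => i _; rewrite !exp1n !muln1.
under eq_bigr do rewrite muln1.
rewrite big_split /= expnS mul2n -addnn; congr addn.
  rewrite (@big_cat_nat _ _ _ (n - x).+1) //=; last by lia.
  rewrite sum_bin big_nat big1 ?addn0 // => i /andP[h _]; exact: bin_small.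
rewrite (@big_cat_nat _ _ _ x) //=; last by lia.
rewrite big_nat big1 ?add0n => [|i /andP[_ ix]]; last by rewrite leqNgt ix.
rewrite -{1}[x]add0n big_addn subSn // -sum_bin.
by apply: eq_bigr => i _; rewrite leq_addl addnK.
Qed.

Lemma weight_w1 n (a : seq nat) : all (geq n) a ->
  (weight n w1 a)%:R = 2 ^+ n.+1 * \sum_(x <- a) f x.
Proof.
elim: a => [|x a IHa] /=; first by rewrite /weight !big_nil mulr0.
case/andP=> xn /IHa; rewrite /weight !big_cons natrD mulrDr => ->.
rewrite F_w1 // natrM natrX /f -subSn // exprB ?leqW ?unitfE ?pnatr_eq0 //.
by rewrite mulrCA mulrA.
Qed.

Lemma partition_le n m a : a \in partitions n m -> all (geq n) a.
Proof.
rewrite inE => /and3P[_ _ /eqP <-].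
elim: a => //= x a IHa; rewrite leq_addr.
by apply: sub_all IHa => y /= h; rewrite (leq_trans h) // leq_addl.
Qed.

Lemma le_weight n m a b : a \in partitions n m -> b \in partitions n m ->
  (weight n w1 a <= weight n w1 b)%N = (\sum_(x <- a) f x <= \sum_(x <- b) f x).
Proof.
move=> /partition_le ha /partition_le hb.
by rewrite -(ler_nat R) !weight_w1 // ler_pM2l // exprn_gt0.
Qed.

Lemma sum_f_tally bs :
  \sum_(y <- tally_seq bs) f y = \sum_(p <- bs) p.2%:R * f p.1.
Proof.
rewrite /tally_seq big_flatten big_map; apply: eq_bigr => -[x k] _ /=.
by rewrite big_nseq iter_addr_0 mulr_natl.
Qed.

Lemma f_values : (f 1 = 1 / 2) * (f 2 = 1 / 2) * (f 3 = 3 / 8) * (f 4 = 1 / 4)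
  * (f 5 = 5 / 32) * (f 6 = 3 / 32) * (f 7 = 7 / 128) * (f 8 = 1 / 32).
Proof. by do !split; rewrite /f !exprS expr0; field. Qed.

Lemma f_ge0 x : 0 <= f x.
Proof. by rewrite /f divr_ge0 // exprn_ge0. Qed.

Lemma size_le_sumn a : all (ltn 0) a -> (size a <= sumn a)%N.
Proof. by elim: a => //= x a IHa /andP[x0 /IHa]; lia. Qed.

(** * Lower bound for n - m <= 5 *)

(** A finite check. The bound 5 is sharp: at s = t = 3, 2 f(4) = 1/2 < f(1) + f(7). *)
Lemma f_superadd s t : (s + t <= 5)%N -> f 1 + f (s + t).+1 <= f s.+1 + f t.+1.
Proof.
by case: s => [|[|[|[|[|[|s]]]]]]; case: t => [|[|[|[|[|[|t]]]]]] st;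
  (exfalso; lia) || (rewrite ?addn0 ?f_values /= ?f_values; lra).
Qed.

(** Adding f(1) on both sides avoids [size a - 1] and covers the empty list. *)
Lemma sum_f_ge_concentrated a :
  all (ltn 0) a -> (sumn a <= size a + 5)%N ->
  (size a)%:R * f 1 + f (sumn a - size a).+1 <= \sum_(x <- a) f x + f 1.
Proof.
elim: a => [|[|x] a IHa] //=; first by rewrite big_nil; lra.
move=> a0 le5; have le_a := size_le_sumn a0.
have := IHa a0 ltac:(lia).
have := @f_superadd x (sumn a - size a) ltac:(lia).
rewrite big_cons -natr1.
have -> : (x.+1 + sumn a - (size a).+1 = x + (sumn a - size a))%N by lia.
by lra.
Qed.

(** * Lower bound from the chord through 1 and 5 *)

(* Here 3t mod 4 = (-t) mod 4, and 128 f(t+1) = 64 - 11t on the chord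
   through t = 0 and t = 4. *)
Lemma f_ge_penalized x :
  64%:R + (3 * x %% 4)%:R <= 128%:R * f x.+1 + 11%:R * x%:R.
Proof.
case: (ltnP x 8) => [|x8].
  by case: x => [|[|[|[|[|[|[|[|x]]]]]]]] // _;
    rewrite f_values; set c := (_ %% 4)%N; compute in c; rewrite /c; lra.
(* For x >= 8, 11x >= 88 exceeds 64 + 3, so f >= 0 suffices. *)
have : (3 * x %% 4 <= 3)%N by rewrite -ltnS ltn_mod.
rewrite -(ler_nat R); have := f_ge0 x.+1.
by move: x8; rewrite -(ler_nat R); lra.
Qed.

Lemma sum_f_ge_penalized a : all (ltn 0) a ->
  64%:R * (size a)%:R + (3 * (sumn a - size a) %% 4)%:R
    <= 128%:R * \sum_(x <- a) f x + 11%:R * (sumn a - size a)%:R.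
Proof.
elim: a => [|[|x] a IHa] //=; first by rewrite big_nil subnn muln0 mod0n; lra.
move=> a0; have le_a := size_le_sumn a0.
have -> : (x.+1 + sumn a - (size a).+1 = x + (sumn a - size a))%N by lia.
move: (f_ge_penalized x) (IHa a0); set N := (sumn a - size a)%N.
have : (3 * (x + N) %% 4 <= 3 * x %% 4 + 3 * N %% 4)%N.
  by rewrite mulnDr -modnDm leq_mod.
by rewrite -(ler_nat R) !natrD big_cons -natr1; lra.
Qed.

(** * Lower bound from the chord through q and q + 1 *)

Lemma pow2_ge_linear s : s%:R + 1 <= 2 ^+ s :> R.
Proof.
elim: s => [|s IHs]; first by rewrite expr0; lra.
have := ler0n R s; rewrite exprS -natr1; lra.
Qed.

(** This is [f_ge_tangent] at x = 2, q = s + 2, cleared of denominators. *)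
Lemma pow2_ge_quad s : s%:R ^+ 2 + 3%:R * s%:R + 4%:R <= 4%:R * 2 ^+ s :> R.
Proof.
elim: s => [|s IHs]; first by rewrite expr0; lra.
have := ler0n R s; have := sqr_ge0 (s%:R : R).
by rewrite [2 ^+ _]exprS -natr1; lra.
Qed.

Lemma f_step q : f q.+1 - f q = (1 - q%:R) / 2 ^+ q.+1.
Proof. by rewrite /f exprS -natr1; field; rewrite expf_neq0 ?pnatr_eq0. Qed.

(** For x >= 2 this is convexity. The point x = 1 lies outside the convex range and forces 4 < q:
    the bound fails there for q = 4. *)
Lemma f_ge_tangent q x : (4 < q)%N -> (0 < x)%N ->
  f q + (f q.+1 - f q) * (x%:R - q%:R) <= f x.
Proof.
move=> q5 x0; rewrite f_step /f.
case: (leqP q x) => [qx|/ltnW xq].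
  set s := (x - q)%N; have -> : x = (q + s)%N by rewrite /s; lia.
  have s2 : 0 < 2 ^+ s :> R by rewrite exprn_gt0.
  have q2 : 0 < 2 ^+ q :> R by rewrite exprn_gt0.
  suff : 2 ^+ s * (2 * q%:R + (1 - q%:R) * s%:R) <= 2 * (q%:R + s%:R) :> R.
    rewrite exprD exprS -subr_ge0 => h; rewrite -subr_ge0.
    rewrite [X in 0 <= X](_ : _ = (2 * (q%:R + s%:R) -
        2 ^+ s * (2 * q%:R + (1 - q%:R) * s%:R)) / (2 * 2 ^+ q * 2 ^+ s)).
      by rewrite divr_ge0 // !mulr_ge0 // ltW.
    by rewrite natrD; field; rewrite !gt_eqF.
  have q5R : 5%:R <= q%:R :> R by rewrite ler_nat.
  case: (leqP s 2) => [|s3].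
    by case: (s) s2 => [|[|[|]]] //= _ _; rewrite ?expr0 ?expr1 ?expr2; lra.
  have s3R : 3%:R <= s%:R :> R by rewrite ler_nat.
  have : 2 * q%:R + (1 - q%:R) * s%:R <= 0 :> R by nra.
  by move=> h; apply: (@le_trans _ _ 0); nra.
set s := (q - x)%N; have -> : q = (x + s)%N by rewrite /s; lia.
have s2 : 0 < 2 ^+ s :> R by rewrite exprn_gt0.
have x2 : 0 < 2 ^+ x :> R by rewrite exprn_gt0.
suff : x%:R * (2 + s%:R) + s%:R * (s%:R + 1) <= 2 * x%:R * 2 ^+ s :> R.
  rewrite exprS exprD -subr_ge0 => h; rewrite -subr_ge0.
  rewrite [X in 0 <= X](_ : _ = (2 * x%:R * 2 ^+ s -
     (x%:R * (2 + s%:R) + s%:R * (s%:R + 1))) / (2 * 2 ^+ x * 2 ^+ s)).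
    by rewrite divr_ge0 // !mulr_ge0 // ltW.
  by rewrite natrD; field; rewrite !gt_eqF.
have s0 := ler0n R s.
(* At x = 1 the claim is s^2 + 2s + 2 <= 2^(s+1), false for s = 3 but true from s = q - 1 = 4 on. *)
case: (leqP x 1) => [x1|x2n].
  have -> : x = 1%N by lia.
  have : (4 <= s)%N by rewrite /s; lia.
  elim: (s) => // k IHk; rewrite leq_eqVlt => /orP[/eqP <-|k4]; first by lra.
  have := IHk k4; move: k4.
  by rewrite ltnS -(ler_nat R) exprS -[k.+1%:R]natr1; nra.
(* The claim is linear in x, and the right side minus the left has slope 2^(s+1) - 2 - s >= 0, so x
   = 2 is the worst case. *)
have x2R : 2%:R <= x%:R :> R by rewrite ler_nat.
by have := pow2_ge_linear s; have := pow2_ge_quad s; nra.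
Qed.

Lemma sum_f_ge_balanced q a : (4 < q)%N -> all (ltn 0) a ->
  (size a)%:R * f q + (f q.+1 - f q) * ((sumn a)%:R - (size a)%:R * q%:R)
    <= \sum_(x <- a) f x.
Proof.
move=> q5; elim: a => [|x a IHa] /=; first by rewrite big_nil; lra.
case/andP=> x0 a0; have := IHa a0; have := f_ge_tangent q5 x0.
by rewrite big_cons -natr1 natrD; lra.
Qed.

(** * Upper bound by merging excesses over 2 *)

Lemma f_merge s t : f s.+2 + f t.+2 <= 1 / 2 + f (s + t).+2.
Proof.
have s2 := pow2_ge_linear s; have t2 := pow2_ge_linear t.
have s0 := ler0n R s; have t0 := ler0n R t.
rewrite -subr_ge0 /f !exprS exprD.
(* With A = 2^s - 1 >= s and B = 2^t - 1 >= t, the numerator is (A - s) B + (B - t) A. *)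
rewrite [X in 0 <= X](_ : _ = (2 * (2 ^+ s - 1) * (2 ^+ t - 1)
   - s%:R * (2 ^+ t - 1) - t%:R * (2 ^+ s - 1)) / (4 * 2 ^+ s * 2 ^+ t)).
  by apply: divr_ge0; [nra | rewrite !mulr_ge0 // exprn_ge0].
by rewrite -[s.+2]addn2 -[t.+2]addn2 -[(s + t).+2]addn2 !natrD; field;
  rewrite !expf_neq0 ?pnatr_eq0.
Qed.

Lemma f_noninc x y : (0 < x)%N -> (x <= y)%N -> f y <= f x.
Proof.
move=> x0; elim: y => [|y IHy]; first by lia.
rewrite leq_eqVlt => /orP[/eqP -> //|xy]; apply: le_trans (IHy xy).
have y1 : 1 <= y%:R :> R by rewrite ler1n; lia.
by rewrite -subr_le0 f_step mulr_le0_ge0 ?invr_ge0 ?exprn_ge0 // subr_le0.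
Qed.

(* When the sum is below 2 * size a, the truncated subtraction makes the last
   term f 2, so the bound is then size a / 2 + 1 / 2. *)
Lemma sum_f_le a : all (ltn 0) a ->
  \sum_(x <- a) f x + 1 / 2 <= (size a)%:R / 2 + f (sumn a - 2 * size a).+2.
Proof.
elim: a => [|x a IHa] /=; first by rewrite big_nil muln0 subnn f_values; lra.
case/andP=> x0 /IHa; rewrite big_cons -[(size a).+1%:R]natr1.
case: x x0 => [|[|s]] // _.
  (* A part 1 contributes f(1) = 1/2 and cannot raise the truncated excess. *)
  have := @f_noninc (1 + sumn a - 2 * (size a).+1).+2
    (sumn a - 2 * size a).+2 isT ltac:(lia).
  by rewrite f_values; lra.
have := f_merge s (sumn a - 2 * size a).
have := @f_noninc (s.+2 + sumn a - 2 * (size a).+1).+2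
  (s + (sumn a - 2 * size a)).+2 isT ltac:(lia).
by lra.
Qed.

(** * Comparison with the listed forms *)

Lemma sum_f_min_form_le n m b : (2 <= m)%N -> (m < n)%N ->
  b \in partitions n m -> \sum_(x <- min_form n m) f x <= \sum_(x <- b) f x.
Proof.
move=> m2 mn; rewrite inE => /and3P[/eqP sz b0 /eqP sm]; rewrite /min_form.
case: ifP => nm5.
  have := sum_f_ge_concentrated b0 ltac:(lia).
  rewrite sum_f_tally !big_cons big_nil /= sz sm addn1 natrB; last by lia.
  by lra.
case: ifP => n5m.
  have q5 : (4 < n %/ m)%N by rewrite leq_divRL; lia.
  have rm : (n %% m < m)%N by rewrite ltn_mod; lia.
  have := sum_f_ge_balanced q5 b0.
  rewrite sum_f_tally !big_cons big_nil /= sz sm addn1 natrB; last exact: ltnW.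
  have -> : n%:R = (n %/ m)%:R * m%:R + (n %% m)%:R :> R.
    by rewrite -natrM -natrD -divn_eq.
  by lra.
have := sum_f_ge_penalized b0; rewrite sz sm natrB; last by exact: ltnW.
(* Here i counts the ones, j the larger parts, k the fours and l the sixes. Fours and sixes have
   scaled gaps 1 and 3 to the chord, so the total gap is c = k + 3l. *)
have casts i j k l c : (m = i + j)%N -> (4 * j + m + l = n + k)%N ->
    (3 * (n - m) %% 4 = c)%N ->
  [/\ m%:R = i%:R + j%:R :> R, 4 * j%:R + m%:R + l%:R = n%:R + k%:R :> R
    & (3 * (n - m) %% 4)%:R = c%:R :> R].
  by move=> em e ->; split; rewrite -?natrM -?natrD ?e -?em.
case: ifP => h0.
  have [] := @casts (m - (n - m) %/ 4)%N ((n - m) %/ 4)%N 0 0 0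
    ltac:(lia) ltac:(lia) ltac:(lia).
  by rewrite sum_f_tally !big_cons big_nil /= !f_values; lra.
case: ifP => h1.
  have [] := @casts (m - (n - m + 1) %/ 4)%N ((n - m - 3) %/ 4).+1 1 0 1
    ltac:(lia) ltac:(lia) ltac:(lia).
  by rewrite -natr1 sum_f_tally !big_cons big_nil /= !f_values; lra.
case: ifP => h2.
  have [] := @casts (m - (n - m + 2) %/ 4)%N ((n - m - 6) %/ 4).+2 2 0 2
    ltac:(lia) ltac:(lia) ltac:(lia).
  by rewrite -addn2 natrD sum_f_tally !big_cons big_nil /= !f_values; lra.
have [] := @casts (m - (n - m - 1) %/ 4)%N ((n - m - 5) %/ 4).+1 0 1 3
  ltac:(lia) ltac:(lia) ltac:(lia).
by rewrite -natr1 sum_f_tally !big_cons big_nil /= !f_values; lra.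
Qed.

Lemma sum_f_le_max_form n m b : (2 <= m)%N -> (m < n)%N ->
  b \in partitions n m -> \sum_(x <- b) f x <= \sum_(x <- max_form n m) f x.
Proof.
move=> m2 mn; rewrite inE => /and3P[/eqP sz b0 /eqP sm]; rewrite /max_form.
have := sum_f_le b0; rewrite sz sm.
case: ifP => nm.
  rewrite sum_f_tally !big_cons big_nil /= addn2 natrB; last by lia.
  by rewrite f_values; lra.
rewrite sum_f_tally !big_cons big_nil /= (_ : n - 2 * m = 0)%N; last by lia.
rewrite !natrB; try lia.
by rewrite natrM !f_values; lra.
Qed.

End HalvingSums.

Local Close Scope ring_scope.

Theorem theorem1 (n m : nat) (hm : 2 <= m) (hmn : m < n) :
  (forall a : seq nat, a \in partitions n m ->
     perm_eq a (min_form n m) -> one_minimal n m a) /\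
  (forall a : seq nat, a \in partitions n m ->
     perm_eq a (max_form n m) -> one_maximal n m a).
Proof.
split=> a ha aform; split=> // b hb.
  rewrite (le_weight rat ha hb) (perm_big _ aform) /=.
  exact: sum_f_min_form_le.
rewrite (le_weight rat hb ha) (perm_big _ aform) /=.
exact: sum_f_le_max_form.
Qed.
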